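(* Fix an integer $d\ge3$. For every $p>1/3$, there is a sequence $(G_n)$ of connected simple graphs of minimum degree $d$, with orders $n\to\infty$ (along some increasing sequence of integers), and parameters $\varepsilon_n\ge0$ with $\varepsilon_n\to0$, such that $$n^2\mu(G_n)\le(d-1)\pi^2+\varepsilon_n,$$ but $$\frac{3n/(d+1)-\operatorname{diam}(G_n)}{n(\varepsilon_n+n^{-1})^p}\longrightarrow\infty.$$ The same assertion holds with the numerator $3n/(d+1)-\operatorname{diam}(G_n)$ replaced by the minimum number of vertices of $G_n$ left uncovered by a family of vertex-disjoint induced copies of $L_d$ in $G_n$, each of which has exactly two boundary edges, both bridges of $G_n$, one at each terminal.
   Context: All graphs are finite, simple and undirected. $\mu(G)$ is the algebraic connectivity (second smallest Laplacian eigenvalue); $\operatorname{diam}(G)$ is the diameter. $L_d=K_{d+1}-e$ is the complete graph on $d+1$ vertices with one edge $e$ removed; its terminals are the endpoints of $e$. A boundary edge of a copy is an edge of the ambient graph with exactly one endpoint in the copy; a bridge is an edge whose deletion disconnects the graph. *)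

(* Defs.v *)
From HB Require Import structures.
From mathcomp Require Import all_boot all_order all_algebra.
From mathcomp Require Import polyrcf.

Set Implicit Arguments.
Unset Strict Implicit.
Unset Printing Implicit Defensive.

Import Order.TTheory GRing.Theory Num.Theory.

Structure sgraph := SGraph {
  vertex :> finType;
  adj : rel vertex;
  adj_sym : symmetric adj;
  adj_irr : irreflexive adj }.

Section Graph.
Variable G : sgraph.

Definition deg (x : G) : nat := #|[set y | adj x y]|.

(* Degrees are smaller than #|G|, so the neutral element #|G| is harmless as
   soon as G has a vertex. *)
Definition min_degree : nat := \big[minn/#|G|]_(x : G) deg x.

Definition connected_graph : bool :=
  (0 < #|G|) && [forall x : G, forall y : G, connect (@adj G) x y].

Definition walk (k : nat) (x y : G) : bool :=
  [exists p : k.-tuple G, path (@adj G) x p && (last x p == y)].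

(* The least length of a walk from x to y; the junk value #|G| is taken exactly
   when y cannot be reached from x. *)
Definition dist (x y : G) : nat := find (fun k => walk k x y) (iota 0 #|G|).

Definition diam : nat := \max_(x : G) \max_(y : G) dist x y.

Definition edges : {set {set G}} :=
  [set [set xy.1; xy.2] | xy : G * G & adj xy.1 xy.2].

Definition boundary (S : {set G}) : {set {set G}} :=
  [set E in edges | #|E :&: S| == 1].

Section DelEdge.
Variable E : {set G}.

Definition del_adj : rel G := [rel x y | adj x y && ([set x; y] != E)].

Lemma del_adj_sym : symmetric del_adj.
Proof. by move=> x y; rewrite /del_adj /= adj_sym setUC. Qed.

Lemma del_adj_irr : irreflexive del_adj.
Proof. by move=> x; rewrite /del_adj /= adj_irr. Qed.

Definition del_edge : sgraph := SGraph del_adj_sym del_adj_irr.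

End DelEdge.

End Graph.

Definition bridge (G : sgraph) (E : {set G}) : bool :=
  (E \in edges G) && ~~ connected_graph (del_edge E).

Section Complete.
Variable n : nat.

Definition complete_adj : rel 'I_n := [rel x y | x != y].

Lemma complete_adj_sym : symmetric complete_adj.
Proof. by move=> x y; rewrite /complete_adj /= eq_sym. Qed.

Lemma complete_adj_irr : irreflexive complete_adj.
Proof. by move=> x; rewrite /complete_adj /= eqxx. Qed.

Definition complete : sgraph := SGraph complete_adj_sym complete_adj_irr.

End Complete.

Definition terminal1 (d : nat) : complete d.+1 := (ord0 : 'I_d.+1).
Definition terminal2 (d : nat) : complete d.+1 := (ord_max : 'I_d.+1).

Definition Lgraph (d : nat) : sgraph := del_edge [set terminal1 d; terminal2 d].

Definition induced_embedding (H G : sgraph) (f : {ffun H -> G}) : bool :=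
  injectiveb f && [forall x, forall y, adj (f x) (f y) == adj x y].

(* S is the vertex set of an induced copy of L_d with exactly two boundary
   edges, both bridges, one at each terminal. *)
Definition bridged_copy (d : nat) (G : sgraph) (S : {set G}) : bool :=
  [exists f : {ffun Lgraph d -> G},
    [&& induced_embedding f,
        S == [set f x | x : Lgraph d],
        #|boundary S| == 2,
        [forall E in boundary S, bridge E],
        #|[set E in boundary S | f (terminal1 d) \in E]| == 1
      & #|[set E in boundary S | f (terminal2 d) \in E]| == 1]].

(* The empty family leaves #|G| vertices uncovered, so the neutral element
   #|G| does not affect the minimum. *)
Definition min_uncovered (d : nat) (G : sgraph) : nat :=
  \big[minn/#|G|]_(P : {set {set G}} |
      trivIset P && [forall S in P, bridged_copy d S])
    #|setC (cover P)|.

Section Laplacian.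
Local Open Scope ring_scope.
Variables (R : rcfType) (G : sgraph).

Definition laplacian : 'M[R]_#|G| :=
  \matrix_(i, j) (if i == j then (deg (enum_val i))%:R
                  else - (adj (enum_val i) (enum_val j))%:R).

(* rootsR lists the distinct real roots in increasing order; the characteristic
   polynomial of the (symmetric) Laplacian splits over R, so this is its full
   spectrum, with multiplicities. *)
Definition laplacian_spectrum : seq R :=
  let p := char_poly laplacian in
  flatten [seq nseq (mup a p) a | a <- rootsR p].

Definition algebraic_connectivity : R := nth 0 laplacian_spectrum 1%N.

End Laplacian.

(* Main.v *)
(* String together many copies of L_d by bridges and put a large clique at both
   ends, with s of the n vertices in each.  The cliques meet no bridged copy of
   L_d and contribute nothing to the diameter, so both defects are of order s.
   The chain behaves like a string of n vertices with conductance d - 1 per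
   vertex whose end pieces are concentrated into point masses; since the
   Neumann eigenfunction cos (pi x / n) is flat at the ends, this
   perturbation raises the Rayleigh quotient by a relative (s / n)^3 only, up to
   a discretisation error 1 / n.  With s = t^3 and n of order t^4 the defect per
   vertex is of order 1 / t, while eps_n is of order 1 / t^3; this is why 1/3 is
   the threshold. *)
Require Import Defs.
From HB Require Import structures.
From mathcomp Require Import all_boot all_order all_algebra.
From mathcomp Require Import all_classical all_reals all_analysis.
From mathcomp Require Import polyrcf complex ring lra zify.

Set Implicit Arguments.
Unset Strict Implicit.
Unset Printing Implicit Defensive.

Import Order.TTheory GRing.Theory Num.Theory.
Import numFieldNormedType.Exports.

Local Open Scope ring_scope.

(** * Rayleigh bound for the algebraic connectivity *)

(** The connectivity is read off the real roots of a characteristic polynomial, so a variational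
    principle has to be set up before a test function can bound it. The test function is a sine in a
    resistance coordinate along the chain. Three consecutive levels advance this coordinate by d + 1
    and hold d + 1 vertices, so mass has density 1 and energy has density d - 1 times the squared
    slope. The delicate choice is the frequency. Half a wave on the chain alone would leave a
    relative error of order (s / n)^2, which is too large. The frequency pi / n, with n counting the
    clique vertices too, makes the sine stop short of its extremum by a phase th of order s / n at
    each end. The missing piece of string would have had mass close to 1 per vertex, and the clique
    supplies this mass up to order s th^2; the terms of first order in th cancel. The cliques also
    stiffen the outermost edges, but the slope there is proportional to th up to discretisation, so
    this again costs s th^2. Against a total mass of order n, this is the cube. *)

Lemma nth1_sorted_le (R : realDomainType) (s : seq R) (B : R) :
  sorted <=%R s -> (1 < count (fun x => (x <= B)%R) s)%N -> nth 0 s 1 <= B.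
Proof.
case: s => [|a [|b s]] //=; first by case: (a <= B).
move=> /andP[_ sb] ct; rewrite leNgt; move: ct.
apply: contraL => ltBb; rewrite -leqNgt.
have /eqP -> : count (fun x => (x <= B)%R) s == 0%N.
  rewrite -leqn0 leqNgt -has_count; apply/hasPn => x xs.
  rewrite -ltNge (lt_le_trans ltBb) //.
  by have /allP/(_ x xs) := order_path_min le_trans sb.
by rewrite (leNgt b) ltBb /= !addn0; case: (a <= B).
Qed.

Lemma sorted_flatten_nseq (R : realDomainType) (m : R -> nat) (s : seq R) :
  sorted <%R s -> sorted <=%R (flatten [seq nseq (m a) a | a <- s]).
Proof.
rewrite lt_sorted_pairwise le_sorted_pairwise.
elim: s => //= a s IHs /andP[/allP ltas /IHs ps].
rewrite pairwise_cat ps andbT; apply/andP; split.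
  apply/allrelP => x y /nseqP[-> _] /flattenP[t /mapP[b bs ->]] /nseqP[-> _].
  exact/ltW/ltas.
by elim: (m a) => //= k ->; rewrite all_nseq lexx orbT.
Qed.

(** * Spectral theorem and Courant-Fischer for real symmetric matrices *)

Section Spectral.
Variable R : rcfType.
Local Notation toC := (real_complex R).
Local Open Scope sesquilinear_scope.

Lemma real_complex_real (x : R) : toC x \is Num.real.
Proof. by rewrite realE !lecE /= eqxx -realE num_real. Qed.

(** Over [R[i]] the matrix is Hermitian, so the complex spectral theorem applies and its diagonal is
    real; the unitary matrix [P] may stay complex. *)
Lemma real_sym_diagonalization n (A : 'M[R]_n) : A^T = A ->
  exists (D : 'rV[R]_n) (P : 'M[R[i]]_n),
    P *m P^t* = 1%:M /\ map_mx toC A = P^t* *m diag_mx (map_mx toC D) *m P.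
Proof.
move=> symA; set A' := map_mx toC A.
have realA : A' \is a mxOver Num.real.
  by apply/mxOverP => i j; rewrite mxE real_complex_real.
have hermA : A' \is hermsymmx.
  apply: realsym_hermsym => //.
  by apply/is_hermitianmxP; rewrite expr0 scale1r map_mx_id // /A' map_trmx symA.
have unP := spectral_unitarymx A'.
exists (map_mx (@complex.Re R) (spectral_diag A')), (spectralmx A').
split; first exact/unitarymxP.
have /hermitian_normalmx/orthomx_spectralP eA := hermA.
rewrite {1}eA -(invmx_unitary unP); congr (_ *m diag_mx _ *m _).
apply/matrixP => i j; rewrite !mxE.
have /mxOverP/(_ i j) := hermitian_spectral_diag_real hermA.
rewrite realE !lecE /= => rD; case: (spectral_diag A' i j) rD => a b /=.
by rewrite (eq_sym 0 b) => /orP[] /andP[/eqP -> _].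
Qed.

Lemma char_poly_conj (F : fieldType) n (P M : 'M[F]_n) : P \in unitmx ->
  char_poly (invmx P *m M *m P) = char_poly M.
Proof.
move=> PU; rewrite /char_poly.
have -> : char_poly_mx (invmx P *m M *m P) =
    map_mx polyC (invmx P) *m char_poly_mx M *m map_mx polyC P.
  rewrite /char_poly_mx !map_mxM mulmxBr mulmxBl; congr (_ - _).
  by rewrite mul_mx_scalar -scalemxAl -map_mxM mulVmx // map_mx1 scalemx1.
by rewrite !det_mulmx mulrAC -det_mulmx -map_mxM mulVmx // map_mx1 det1 mul1r.
Qed.

Lemma char_poly_diagonalization n (A : 'M[R]_n) (D : 'rV[R]_n) (P : 'M[R[i]]_n) :
  P *m P^t* = 1%:M -> map_mx toC A = P^t* *m diag_mx (map_mx toC D) *m P ->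
  char_poly A = \prod_(a <- codom (D 0)) ('X - a%:P).
Proof.
move=> PP eA; apply: (map_poly_inj toC).
have PU : P \in unitmx by have [] := mulmx1_unit PP.
have eI : P^t* = invmx P by rewrite -[LHS](mulKmx PU) PP mulmx1.
have -> : map_poly toC (char_poly A) = char_poly (diag_mx (map_mx toC D)).
  by rewrite map_char_poly eA eI char_poly_conj.
rewrite char_poly_trig ?diag_mx_is_trig // rmorph_prod big_map big_enum /=.
by apply: eq_bigr => i _; rewrite !mxE eqxx mulr1n rmorphB /= map_polyX map_polyC.
Qed.

(* Courant-Fischer: if at most one eigenvalue were at most B, some nonzero
   combination of u and v would be orthogonal to its eigenvector, hence have a
   Rayleigh quotient larger than B.  The eigenvectors are complex, so the
   combination must have complex coefficients too. *)
Lemma count_spectrum_le n (A : 'M[R]_n) (D : 'rV[R]_n) (P : 'M[R[i]]_n)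
    (u v : 'rV[R]_n) (B : R) :
  P *m P^t* = 1%:M -> map_mx toC A = P^t* *m diag_mx (map_mx toC D) *m P ->
  u *m A = 0 -> u *m v^T = 0 -> A^T = A -> 0 <= B -> u != 0 -> v != 0 ->
  (v *m A *m v^T) 0 0 <= B * (v *m v^T) 0 0 ->
  (1 < count (fun x => (x <= B)%R) (codom (D 0%R)))%N.
Proof.
move=> PP eA uA0 uv0 symA B0 u0 v0 leB.
have PU : P \in unitmx by have [] := mulmx1_unit PP.
have PP' : P^t* *m P = 1%:M by apply: mulmx1C.
pose y (w : 'rV[R[i]]_n) := w *m P^t*.
pose N (w : 'rV[R[i]]_n) := (w *m w^t*) 0 0.
have NE w : N w = \sum_i `|w 0 i| ^+ 2.
  by rewrite /N mxE; apply: eq_bigr => i _; rewrite !mxE normCK.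
have yt w : (y w)^t* = P *m w^t* by rewrite /y trmx_mul map_mxM trmxCK.
have Ny w : N (y w) = N w.
  by rewrite /N yt mulmxA /y -(mulmxA w) PP' mulmx1.
have Ay w : (w *m map_mx toC A *m w^t*) 0 0 =
    \sum_i toC (D 0 i) * `|y w 0 i| ^+ 2.
  have -> : w *m map_mx toC A *m w^t* =
      y w *m diag_mx (map_mx toC D) *m (y w)^t*.
    by rewrite yt eA /y !mulmxA.
  rewrite mxE; apply: eq_bigr => i _.
  by rewrite mul_mx_diag !mxE mulrAC -normCK mulrC.
rewrite ltnNge; apply/negP => cle1.
(* [i0] is the one index whose eigenvalue may be at most [B]. If there is none, any index serves,
   and [u != 0] guarantees that one exists. *)
have [i0 i0P] : exists i0 : 'I_n, forall i, i != i0 -> B < D 0 i.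
  have n0 : (0 < n)%N.
    by case: n u u0 {y N NE yt Ny Ay PP PP' PU eA uA0 uv0 leB symA A v v0 D P cle1} =>
      // u; rewrite thinmx0 eqxx.
  move: cle1; rewrite count_map -size_filter.
  have -> : size [seq x <- enum 'I_n | preim (D 0) (fun x => (x <= B)%R) x] =
     #|[pred i | (D 0 i <= B)%R]|.
    rewrite cardE /enum_mem -filter_predI; congr size.
    by apply: eq_filter => i; rewrite /= andbT.
  rewrite leq_eqVlt ltnS leqn0 => /orP[/eqP/eqP/card1P [i iP]|/eqP/card0_eq c0].
    by exists i => j; have := iP j; rewrite !inE => <-; rewrite -ltNge.
  by exists (Ordinal n0) => j _; have := c0 j; rewrite !inE ltNge => ->.
pose u' := map_mx toC u; pose v' := map_mx toC v.
have real_conj m p (M : 'M[R]_(m, p)) : map_mx Num.conj (map_mx toC M) = map_mx toC M.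
  by apply/matrixP => i j; rewrite !mxE; apply/CrealP/real_complex_real.
have [a [b [ab0 yab]]] : exists a b : R[i], (a != 0) || (b != 0) /\
    (y (a *: u' + b *: v')) 0 i0 = 0.
  have ylin a b : (y (a *: u' + b *: v')) 0 i0 = a * y u' 0 i0 + b * y v' 0 i0.
    by rewrite /y mulmxDl -!scalemxAl !mxE.
  have [yu|yu] := eqVneq (y u' 0 i0) 0.
    by exists 1, 0; rewrite ylin yu mulr0 mul0r addr0 oner_neq0.
  exists (y v' 0 i0), (- y u' 0 i0); rewrite oppr_eq0 yu orbT; split=> //.
  by rewrite ylin mulNr mulrC subrr.
set w := a *: u' + b *: v'.
have wt : w^t* = a^* *: u'^T + b^* *: v'^T.
  by rewrite /w linearD /= !linearZ /= map_mxD !map_mxZ /u' /v' !map_trmx !real_conj.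
have vu0 : v *m u^T = 0 by rewrite -[LHS]trmxK trmx_mul trmxK uv0 trmx0.
have Au0 : A *m u^T = 0 by rewrite -[LHS]trmxK trmx_mul trmxK symA uA0 trmx0.
have uA' : u' *m map_mx toC A = 0 by rewrite -map_mxM uA0 map_mx0.
have Au' : map_mx toC A *m u'^T = 0 by rewrite map_trmx -map_mxM Au0 map_mx0.
have uv' : u' *m v'^T = 0 by rewrite map_trmx -map_mxM uv0 map_mx0.
have vu' : v' *m u'^T = 0 by rewrite map_trmx -map_mxM vu0 map_mx0.
have Nw : N w = `|a| ^+ 2 * toC ((u *m u^T) 0 0) + `|b| ^+ 2 * toC ((v *m v^T) 0 0).
  rewrite /N wt /w mulmxDl !mulmxDr -!scalemxAl -!scalemxAr uv' vu' !scaler0.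
  by rewrite addr0 add0r !scalerA -!normCK /u' /v' !map_trmx -!map_mxM !mxE.
have Aw : (w *m map_mx toC A *m w^t*) 0 0 = `|b| ^+ 2 * toC ((v *m A *m v^T) 0 0).
  rewrite wt /w mulmxDl -!scalemxAl uA' scaler0 add0r mulmxDr -!scalemxAr -!scalemxAl.
  rewrite -(mulmxA v') Au' mulmx0 !scaler0 add0r scalerA mulrC -normCK.
  by rewrite /v' !map_trmx -!map_mxM !mxE.
have sq_ge0 (z : 'rV[R]_n) : 0 <= (z *m z^T) 0 0.
  by rewrite mxE; apply: sumr_ge0 => i _; rewrite mxE -expr2 sqr_ge0.
have sq_gt0 (z : 'rV[R]_n) : z != 0 -> 0 < (z *m z^T) 0 0.
  move=> z0; rewrite lt0r sq_ge0 andbT; apply: contra z0.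
  rewrite mxE psumr_eq0 => [/allP zP|i _]; last by rewrite mxE -expr2 sqr_ge0.
  apply/eqP/rowP => i; have := zP i (mem_index_enum i).
  by rewrite !mxE /= mulf_eq0 orbb => /eqP.
have Nw_gt0 : 0 < N w.
  rewrite Nw; case/orP: ab0 => h; [apply: ltr_pwDl|apply: ltr_pwDr];
  rewrite ?mulr_gt0 ?mulr_ge0 ?exprn_gt0 ?exprn_ge0 ?normr_gt0 ?normr_ge0 //.
  - by rewrite (ltcR 0) sq_gt0.
  - by rewrite (lecR 0) sq_ge0.
  - by rewrite (ltcR 0) sq_gt0.
  - by rewrite (lecR 0) sq_ge0.
have le_w : \sum_i toC (D 0 i) * `|y w 0 i| ^+ 2 <= \sum_i toC B * `|y w 0 i| ^+ 2.
  rewrite -Ay Aw -mulr_sumr -NE Ny Nw mulrDr.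
  rewrite -[X in X <= _]add0r lerD //.
    by rewrite !mulr_ge0 ?exprn_ge0 ?normr_ge0 // (lecR 0).
  by rewrite mulrCA ler_wpM2l ?exprn_ge0 ?normr_ge0 // -rmorphM lecR.
(* The terms with factor [D 0 i - B] are nonnegative, the one at [i0] being killed by [yab], while
   [le_w] makes their sum at most 0. So all coordinates of [y w] vanish, against [Nw_gt0]. *)
have yw0 i : y w 0 i = 0.
  have [->//|ni] := eqVneq i i0.
  move: le_w; rewrite -subr_ge0 -sumrB -oppr_le0 -sumrN => le_w.
  have pos j : 0 <= - (toC B * `|y w 0 j| ^+ 2 - toC (D 0 j) * `|y w 0 j| ^+ 2).
    have [->|nj] := eqVneq j i0.
      by rewrite yab normr0 expr0n /= !mulr0 subrr oppr0.
    rewrite opprB -mulrBl mulr_ge0 ?exprn_ge0 ?normr_ge0 //.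
    by rewrite subr_ge0 lecR ltW // i0P.
  have: \sum_j - (toC B * `|y w 0 j| ^+ 2 - toC (D 0 j) * `|y w 0 j| ^+ 2) == 0.
    by rewrite eq_le le_w sumr_ge0.
  rewrite psumr_eq0 // => /allP/(_ i (mem_index_enum i)) /=.
  rewrite opprB -mulrBl mulf_eq0 subr_eq0 (inj_eq (@complexI R)).
  by rewrite gt_eqF ?i0P //= sqrf_eq0 normr_eq0 => /eqP.
by move: Nw_gt0; rewrite -Ny NE big1 ?ltxx // => i _; rewrite yw0 normr0 expr0n.
Qed.

End Spectral.

(** * The Laplacian quadratic form *)

Section Rayleigh.
Variables (R : rcfType) (G : sgraph).
Local Notation A := (laplacian R G).
Local Notation vec f := (\row_(i < #|G|) f (enum_val i)).

Lemma laplacian_sym : A^T = A.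
Proof.
apply/matrixP => i j; rewrite !mxE eq_sym; case: eqP => [->//|_].
by rewrite adj_sym.
Qed.

Lemma mulmx_laplacian (f : G -> R) :
  vec f *m A =
  \row_j \sum_y (adj (enum_val j) y)%:R * (f (enum_val j) - f y).
Proof.
apply/rowP => j; rewrite !mxE (bigD1 j) //= !mxE eqxx.
under eq_bigr => i ij do rewrite !mxE (negPf ij) adj_sym mulrN mulrC.
rewrite sumrN; set x := enum_val j.
have -> : \sum_(i < #|G| | i != j) (adj x (enum_val i))%:R * f (enum_val i) =
    \sum_y (adj x y)%:R * f y.
  rewrite [RHS](reindex (@enum_val G G)) /=; last first.
    by apply: onW_bij; apply: enum_val_bij.
  by rewrite [RHS](bigD1 j) //= -/x adj_irr mul0r add0r.
under [in RHS]eq_bigr do rewrite mulrBr.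
rewrite sumrB -mulr_suml mulrC; congr (_ * _ - _).
rewrite /deg -sum1_card natr_sum big_mkcond; apply: eq_bigr => y _.
by rewrite inE; case: adj.
Qed.

Lemma mulmx_rowT (f g : G -> R) :
  (vec f *m (vec g)^T) 0 0 = \sum_x f x * g x.
Proof.
rewrite mxE [RHS](reindex (@enum_val G G)) /=; last first.
  by apply: onW_bij; apply: enum_val_bij.
by apply: eq_bigr => i _; rewrite !mxE.
Qed.

Lemma laplacian_form (f : G -> R) :
  (vec f *m A *m (vec f)^T) 0 0 *+ 2 =
  \sum_x \sum_y (adj x y)%:R * (f x - f y) ^+ 2.
Proof.
rewrite mulmx_laplacian.
rewrite (mulmx_rowT (fun x => \sum_y (adj x y)%:R * (f x - f y)) f) mulr2n.
under eq_bigr => x _ do rewrite mulr_suml.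
rewrite [X in _ + X]exchange_big -big_split /=; apply: eq_bigr => x _.
rewrite -big_split /=; apply: eq_bigr => y _; rewrite (adj_sym y x).
by ring.
Qed.

(** [rootsR] lists each root once, and the multiplicity of a root in a product of linear factors is
    its number of occurrences in [s]. *)
Lemma perm_spectrum (s : seq R) :
  char_poly A = \prod_(a <- s) ('X - a%:P) -> perm_eq (laplacian_spectrum R G) s.
Proof.
move=> es; rewrite /laplacian_spectrum.
have p0 : char_poly A != 0 by rewrite monic_neq0 // char_poly_monic.
have rP := roots_on_rootsR p0.
have ur : uniq (rootsR (char_poly A)).
  by apply: (sorted_uniq lt_trans) => //; exact: sorted_roots.
apply/allP => a _ /=; apply/eqP.
rewrite count_flatten -map_comp.
rewrite (eq_map (g := fun b => if b == a then mup a (char_poly A) else 0%N)); last first.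
  by move=> b /=; rewrite count_nseq /= ; case: eqP => [->|_]; rewrite ?mul1n ?mul0n.
rewrite sumnE big_map -big_mkcond /= big_const_seq iter_addn_0.
rewrite (count_uniq_mem _ ur) -rP /= {1 2}es mu_prod_XsubC.
rewrite root_prod_XsubC; case: (boolP (a \in s)); rewrite ?muln1 ?muln0 //.
by move=> /count_memPn ->.
Qed.

(** Constants span a direction of zero energy, and the zero sum makes [f] orthogonal to it, so two
    eigenvalues are at most [B]. The double sum meets every edge twice, whence the factor 2 on the
    right. *)
Theorem algebraic_connectivity_le (f : G -> R) (B : R) :
  0 <= B -> \sum_x f x = 0 -> (exists x, f x != 0) ->
  \sum_x \sum_y (adj x y)%:R * (f x - f y) ^+ 2 <= B * (\sum_x f x ^+ 2) *+ 2 ->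
  algebraic_connectivity R G <= B.
Proof.
move=> B0 f0 [x0 fx0] leB.
have [D [P [PP eA]]] := real_sym_diagonalization laplacian_sym.
have ps := perm_spectrum (char_poly_diagonalization PP eA).
apply: nth1_sorted_le.
  by apply: sorted_flatten_nseq; exact: sorted_roots.
rewrite (permP ps).
apply: (count_spectrum_le (u := vec (fun=> 1))
  (v := vec f) PP eA) => //.
- rewrite (mulmx_laplacian (fun=> 1)); apply/rowP => j; rewrite !mxE.
  by rewrite big1 // => y _; rewrite subrr mulr0.
- apply/matrixP => i j; rewrite !ord1 (mulmx_rowT (fun=> 1) f) mxE -[RHS]f0.
  by apply: eq_bigr => x _; rewrite mul1r.
- exact: laplacian_sym.
- apply/eqP => /rowP/(_ (enum_rank x0)); rewrite !mxE => /eqP.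
  by rewrite oner_eq0.
- apply: contra fx0 => /eqP/rowP/(_ (enum_rank x0)).
  by rewrite !mxE enum_rankK => ->.
rewrite -(ler_pMn2r (n := 2)) // laplacian_form (le_trans leB) //.
by rewrite mulmx_rowT; under [in leRHS]eq_bigr do rewrite -expr2.
Qed.

End Rayleigh.

(** * Blow-ups of paths *)

Section Distance.
Variable G : sgraph.

Lemma walk_connect k (x y : G) : walk k x y -> connect (@adj G) x y.
Proof. by case/existsP=> p /andP[xp /eqP <-]; apply/connectP; exists p. Qed.

Lemma dist_walk k (x y : G) : walk k x y -> (dist x y <= k)%N.
Proof.
move=> wk; rewrite /dist; case: (ltnP k #|G|) => [ltk|lek]; last first.
  by rewrite (leq_trans (find_size _ _)) // size_iota.
rewrite leqNgt; apply/negP => /(before_find 0%N).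
by rewrite nth_iota // add0n wk.
Qed.

(** A function that some edge always lowers dominates the distance. This yields connectedness and
    the diameter bound together, with no exact distance computed. *)
Lemma walk_of_descent (rho : G -> G -> nat) :
  (forall x y, x != y -> exists2 z, adj x z & (rho z y < rho x y)%N) ->
  forall x y, exists2 k, (k <= rho x y)%N & walk k x y.
Proof.
move=> desc x y; move en: (rho x y) => n.
elim/ltn_ind: n x en => n IHn x en.
have [->|xy] := eqVneq x y.
  by exists 0%N => //; apply/existsP; exists [tuple]; rewrite /= eqxx.
have [z xz ltz] := desc x y xy.
rewrite en in ltz; have [k lek /existsP[p /andP[zp lp]]] := IHn _ ltz z erefl.
exists k.+1; first exact: leq_ltn_trans lek ltz.
by apply/existsP; exists [tuple of z :: p]; rewrite /= xz zp.
Qed.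

End Distance.

Lemma bigminn_le (I : eqType) (s : seq I) (P : pred I) (F : I -> nat) n0 x :
  x \in s -> P x -> (\big[minn/n0]_(i <- s | P i) F i <= F x)%N.
Proof.
elim: s => //= y s IHs; rewrite inE big_cons => /orP[/eqP <- ->|/IHs leF Px].
  exact: geq_minl.
by case: ifP => _; rewrite ?geq_min leF ?orbT.
Qed.

(* The path on N vertices with its l-th vertex blown up to a clique of size w l. *)
Section LevelGraph.
Variables (N : nat) (w : nat -> nat).

Definition level_vertex : finType := {l : 'I_N & 'I_(w l)}.

Definition level (x : level_vertex) : nat := tag x.

Definition level_adj : rel level_vertex :=
  [rel x y | [&& x != y, (level x <= (level y).+1)%N & (level y <= (level x).+1)%N]].

Lemma level_adj_sym : symmetric level_adj.
Proof. by move=> x y; rewrite /level_adj /= eq_sym; congr (_ && _); rewrite andbC. Qed.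

Lemma level_adj_irr : irreflexive level_adj.
Proof. by move=> x; rewrite /level_adj /= eqxx. Qed.

Definition level_graph : sgraph := SGraph level_adj_sym level_adj_irr.

Lemma ltn_level (x : level_graph) : (level x < N)%N.
Proof. exact: ltn_ord. Qed.

Lemma sum_level (V : nmodType) (P : pred nat) (F : nat -> V) :
  \sum_(x : level_graph | P (level x)) F (level x) = \sum_(l < N | P l) F l *+ w l.
Proof.
under [RHS]eq_bigr => l _ do rewrite -[X in _ *+ X]card_ord -sumr_const.
rewrite (sig_big_dep (J := fun l : 'I_N => 'I_(w l)) P (fun=> xpredT)
  (fun l _ => F l)).
by apply: eq_bigl => x; rewrite andbT.
Qed.

Lemma card_level_graph : #|level_graph| = (\sum_(l < N) w l)%N.
Proof.
rewrite -sum1_card (sum_level xpredT (fun=> 1%N)).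
by apply: eq_bigr => l _; rewrite natn.
Qed.

(** The successor accounts for [x] itself: its closed neighbourhood is a union of whole levels. *)
Lemma deg_level (x : level_graph) :
  (deg x).+1 = (\sum_(l < N | (l <= (level x).+1) && (level x <= l.+1)) w l)%N.
Proof.
have -> : (deg x).+1 = #|[set y : level_graph |
    (level y <= (level x).+1) && (level x <= (level y).+1)]%N|.
  rewrite (cardsD1 x) inE !leqnSn add1n; congr _.+1; apply: eq_card => y.
  by rewrite !inE /= eq_sym; congr (_ && _); rewrite andbC.
rewrite -sum1dep_card.
rewrite (sum_level (fun l => (l <= (level x).+1) && (level x <= l.+1))%N (fun=> 1%N)).
by apply: eq_bigr => l _; rewrite natn.
Qed.

Lemma clique_level (x y : level_graph) : x != y -> level x = level y -> adj x y.
Proof. by move=> xy e; rewrite /= /level_adj /= xy e leqnSn. Qed.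

Hypothesis w_gt0 : forall l, (l < N)%N -> (0 < w l)%N.

(** The [maxn 1] serves distinct vertices of one level, which are adjacent although their levels
    agree. *)
Definition level_rho (x y : level_graph) : nat :=
  if x == y then 0%N
  else maxn 1 ((level x - level y) + (level y - level x))%N.

Lemma level_graph_descent (x y : level_graph) :
  x != y -> exists2 z, adj x z & (level_rho z y < level_rho x y)%N.
Proof.
move=> xy; rewrite [level_rho x y]/level_rho (negPf xy).
have [near|far] := boolP ((level x <= (level y).+1) && (level y <= (level x).+1))%N.
  by exists y; rewrite /level_rho ?eqxx ?leq_max //= /level_adj /= xy.
pose l := if (level x < level y)%N then (level x).+1 else (level x).-1.
have ltl : (l < N)%N.
  rewrite /l; have := ltn_level x; have := ltn_level y.
  by case: ifP; lia.
pose z : level_graph :=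
  Tagged (fun l : 'I_N => 'I_(w l)) (Ordinal (w_gt0 ltl) : 'I_(w (Ordinal ltl))).
have lz : level z = l by [].
exists z.
  rewrite /= /level_adj /= lz; apply/andP; split; last first.
    by move: far; rewrite /l; case: ifP; lia.
  by apply/eqP => e; have := lz; rewrite -e /l; move: far; case: ifP; lia.
rewrite /level_rho lz; case: (z == y); first by rewrite leq_max.
by move: far; rewrite /l; case: ifP; lia.
Qed.

(** Only the number of levels matters, so enlarging a level is free. A single level would be a
    clique, of diameter possibly 1, whence [1 < N]. *)
Lemma diam_level_graph : (1 < N)%N -> (diam level_graph <= N.-1)%N.
Proof.
move=> N1; rewrite /diam; apply/bigmax_leqP => x _; apply/bigmax_leqP => y _.
have [k lek wk] := walk_of_descent level_graph_descent x y.
apply: leq_trans (dist_walk wk) _; apply: leq_trans lek _.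
have := ltn_level x; have := ltn_level y.
by rewrite /level_rho; case: (x == y); lia.
Qed.

Lemma connected_level_graph : (0 < N)%N -> connected_graph level_graph.
Proof.
move=> N0; apply/andP; split; last first.
  apply/forallP => x; apply/forallP => y.
  have [k _ wk] := walk_of_descent level_graph_descent x y.
  exact: walk_connect wk.
rewrite card_level_graph (bigD1 (Ordinal N0)) //=.
exact: leq_trans (w_gt0 N0) (leq_addr _ _).
Qed.

End LevelGraph.

Arguments sum_level {N w V}.

Lemma sum_tridiagonal (V : nmodType) (c : nat -> nat -> V) n :
  (forall a, c a a = 0) -> (forall a b, c a b = c b a) ->
  (forall a b, (a.+1 < b)%N -> c a b = 0) ->
  \sum_(a < n.+1) \sum_(b < n.+1) c a b = (\sum_(a < n) c a a.+1) *+ 2.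
Proof.
move=> c0 cs cf; elim: n => [|n IHn]; first by rewrite !big_ord1 big_ord0 c0 mul0rn.
have edge : \sum_(a < n.+1) c a n.+1 = c n n.+1.
  by rewrite big_ord_recr /= big1 ?add0r // => a _; rewrite cf // ltnS.
rewrite big_ord_recr /= [X in _ + X]big_ord_recr /= c0 addr0.
under eq_bigr => a _ do rewrite big_ord_recr.
rewrite big_split /= {}IHn edge.
under eq_bigr => a _ do rewrite cs.
by rewrite edge [in RHS]big_ord_recr /= mulrnDl -addrA -mulr2n.
Qed.

(** Edges inside a level carry no energy, and consecutive levels are completely joined, by
    [w l * w l.+1] edges. *)
Lemma energy_level_graph (R : rcfType) n (w : nat -> nat) (F : nat -> R) :
  \sum_(x : level_graph n.+1 w) \sum_y (adj x y)%:R * (F (level x) - F (level y)) ^+ 2 =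
  (\sum_(l < n) (w l * w l.+1)%:R * (F l.+1 - F l) ^+ 2) *+ 2.
Proof.
pose near a b := ((a <= b.+1) && (b <= a.+1))%N.
pose c a b := (near a b)%:R * (F a - F b) ^+ 2.
have adjE (x y : level_graph n.+1 w) :
    (@adj (level_graph n.+1 w) x y)%:R * (F (level x) - F (level y)) ^+ 2 =
      c (level x) (level y).
  rewrite /c /near /= /level_adj /=; have [->|//] := eqVneq x y.
  by rewrite subrr expr0n !mulr0.
under eq_bigr => x _ do under eq_bigr => y _ do rewrite adjE.
under eq_bigr => x _ do rewrite (sum_level xpredT (c (level x))).
rewrite (sum_level xpredT (fun a => \sum_(b < n.+1) c a b *+ w b)).
under eq_bigr => a _ do rewrite -sumrMnl.
rewrite (sum_tridiagonal (c := fun a b => c a b *+ w b *+ w a)).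
- congr (_ *+ 2); apply: eq_bigr => l _; rewrite /c /near leqnn leqW // mul1r.
  by rewrite -mulrnA mulnC mulr_natl -[in RHS]sqrrN opprB.
- by move=> a; rewrite /c subrr expr0n mulr0 !mul0rn.
- by move=> a b; rewrite mulrnAC /c /near [in RHS]andbC -[in RHS]sqrrN opprB.
move=> a b ab; rewrite /c /near (leqNgt b) ab andbF mul0r !mul0rn //.
Qed.

(** * The chain of copies of L_d *)

Section Chain.
Local Open Scope nat_scope.

(* Levels 3j+2, 3j+3, 3j+4 induce a copy of L_d, its terminals being the two
   singleton levels; levels 0 and 3m carry the large cliques. *)
Definition chain_weight (d m s l : nat) : nat :=
  if l %% 3 == 0 then (if (l == 0) || (l == 3 * m) then s else d.-1) else 1.

Definition chain (d m s : nat) : sgraph :=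
  level_graph (3 * m).+1 (chain_weight d m s).

Variables d m s : nat.
Hypotheses (d_ge3 : (3 <= d)%N) (m_ge2 : (2 <= m)%N) (s_ge : (d + 4 <= s)%N).
Local Notation w := (chain_weight d m s).
Local Notation G := (chain d m s).

Lemma chain_weight3 j : w (3 * j) = if (j == 0) || (j == m) then s else d.-1.
Proof.
rewrite /chain_weight modnMr eqxx muln_eq0 /=.
by rewrite eqn_mul2l.
Qed.

Lemma chain_weight31 j : w (3 * j).+1 = 1%N.
Proof. by rewrite /chain_weight -addn1 mulnC modnMDl. Qed.

Lemma chain_weight32 j : w (3 * j).+2 = 1%N.
Proof. by rewrite /chain_weight -addn2 mulnC modnMDl. Qed.

Lemma chain_weight_gt0 l : (0 < w l)%N.
Proof. by rewrite /chain_weight; case: ifP => // _; case: ifP => _; lia. Qed.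

Lemma chain_connected : connected_graph G.
Proof. by apply: connected_level_graph => // l _; apply: chain_weight_gt0. Qed.

Lemma chain_diam : (diam G <= 3 * m)%N.
Proof.
apply: (diam_level_graph (N := (3 * m).+1)); last by lia.
by move=> l _; apply: chain_weight_gt0.
Qed.

Lemma near_sum (N L : nat) (v : nat -> nat) : (L.+2 < N)%N ->
  (\sum_(l < N | (l <= L.+2) && (L.+1 <= l.+1)) v l = v L + v L.+1 + v L.+2)%N.
Proof.
move=> ltN; rewrite -(big_mkord (fun l => (l <= L.+2) && (L.+1 <= l.+1))%N v).
rewrite (@big_cat_nat _ _ _ L) ?leq0n //=; last by lia.
rewrite big_nat_cond big1 ?add0n; last by move=> i; lia.
rewrite (@big_cat_nat _ _ _ L.+3) //=; last by lia.
rewrite [X in (_ + X)%N]big_nat_cond [X in (_ + X)%N]big1 ?addn0; last by move=> i; lia.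
do 3 (rewrite big_ltn_cond; last by lia).
rewrite big_geq // addn0.
do 3 (rewrite ifT; last by lia).
by rewrite addnA.
Qed.

Lemma near_sum_ge (N L l1 l2 : nat) (v : nat -> nat) :
  (l1 < N)%N -> (l2 < N)%N -> (l1 <= L.+1)%N -> (L <= l1.+1)%N ->
  (l2 <= L.+1)%N -> (L <= l2.+1)%N -> l1 != l2 ->
  (v l1 + v l2 <= \sum_(l < N | (l <= L.+1) && (L <= l.+1)) v l)%N.
Proof.
move=> h1 h2 a1 b1 a2 b2 ne; rewrite (bigD1 (Ordinal h1)) /= ?a1 ?b1 //.
rewrite (bigD1 (Ordinal h2)) /= ?a2 ?b2 //=; last by rewrite -val_eqE /= eq_sym.
by rewrite addnA leq_addr.
Qed.

(** Away from the ends, a closed neighbourhood consists of two singleton levels and one level of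
    size at least [d - 1]. At the ends, a clique and one further vertex already give more than
    [d]. *)
Lemma chain_deg_ge (x : G) : (d <= deg x)%N.
Proof.
rewrite -ltnS deg_level; have := ltn_level x; set L := level x; rewrite ltnS => ltL.
have [L0|L0] := eqVneq L 0%N.
  apply: leq_trans (near_sum_ge (l1 := 0) (l2 := 1) _ _ _ _ _ _ _ _);
    rewrite ?L0 //; try lia.
  by rewrite (chain_weight3 0) (chain_weight31 0) /=; lia.
have [Lm|Lm] := eqVneq L (3 * m)%N.
  apply: leq_trans (near_sum_ge (l1 := (3 * m)%N) (l2 := (3 * m.-1).+2) _ _ _ _ _ _ _ _);
    rewrite ?Lm //; try lia.
  by rewrite chain_weight3 chain_weight32 eqxx orbT; lia.
have [L' eL] : exists L', L = L'.+1 by exists L.-1; lia.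
rewrite eL near_sum; last by lia.
have := divn_eq L 3; have := ltn_pmod L (isT : (0 < 3)%N).
set j := (L %/ 3)%N => r3 e.
have wj k : (d.-1 <= w (3 * k))%N by rewrite chain_weight3; case: ifP => _; lia.
have : [|| L == (3 * j)%N, L == (3 * j).+1 | L == (3 * j).+2] by lia.
case/or3P => /eqP eLj.
- have -> : L' = (3 * j.-1).+2 by lia.
  rewrite chain_weight32 (_ : (3 * j.-1).+3 = 3 * j)%N; last by lia.
  by rewrite chain_weight31; have := wj j; lia.
- have -> : L' = (3 * j)%N by lia.
  by rewrite chain_weight31 chain_weight32; have := wj j; lia.
have -> : L' = (3 * j).+1 by lia.
rewrite chain_weight31 chain_weight32 (_ : (3 * j).+3 = 3 * j.+1)%N; last by lia.
by have := wj j.+1; lia.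
Qed.

Lemma chain_min_degree : min_degree G = d.
Proof.
have h3 : (3 < (3 * m).+1)%N by lia.
have w3 : (0 < w (Ordinal h3))%N by apply: chain_weight_gt0.
(* Since [m >= 2], level 3 is not an end, and its neighbourhood realises the minimum. *)
pose x : G := Tagged (fun l : 'I_(3 * m).+1 => 'I_(w l)) (Ordinal w3).
have dx : deg x = d.
  apply: succn_inj; rewrite deg_level (_ : level x = 3) // near_sum; last by lia.
  rewrite (chain_weight32 0) (chain_weight3 1) (chain_weight31 1) /=.
  by case: eqP; lia.
apply/eqP; rewrite eqn_leq /min_degree; apply/andP; split.
  by rewrite -[leqRHS]dx; apply: bigminn_le => //; apply: mem_index_enum.
apply: (big_ind (fun k => d <= k)%N).
- by rewrite (leq_trans (chain_deg_ge x)) // max_card.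
- by move=> a b; rewrite leq_min => -> ->.
by move=> y _; apply: chain_deg_ge.
Qed.

Definition end_clique : {set G} := [set x : G | level x == 0%N].

Lemma card_end_clique : #|end_clique| = s.
Proof.
rewrite -sum1dep_card (sum_level (fun l => l == 0)%N (fun=> 1%N)).
rewrite (bigD1 ord0) //= big1 => [|l /andP[/eqP l0]]; last first.
  by rewrite -val_eqE /= l0.
by rewrite addr0 natn (chain_weight3 0).
Qed.

(** A copy has at most [d + 1] vertices, so [s >= d + 4] leaves at least three clique vertices
    outside it. A common vertex [x] would be joined to each of them by a boundary edge, but there
    are only two. *)
Lemma bridged_copy_end_clique (S : {set G}) :
  bridged_copy d S -> [disjoint S & end_clique].
Proof.
case/existsP => f /and5P[_ /eqP eS /eqP b2 _ _].
have cS : (#|S| <= d.+1)%N.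
  by rewrite eS (leq_trans (leq_imset_card _ _)) // card_ord.
apply/pred0P => x /=; apply/negP => /andP[xS xK].
pose T := end_clique :\: S.
have cT : (2 < #|T|)%N.
  have := cardsID S end_clique; rewrite card_end_clique -/T.
  have : (#|end_clique :&: S| <= #|S|)%N by rewrite subset_leq_card // subsetIr.
  lia.
have yx y : y \in T -> y != x by apply: contraTneq => ->; rewrite inE xS.
have injT : {in T &, injective (fun y => [set x; y])}.
  move=> y z yT zT /setP/(_ y); rewrite !inE eqxx (negPf (yx y yT)) /=.
  by move/esym/eqP.
have : [set [set x; y] | y in T] \subset boundary S.
  apply/fintype.subsetP => E /imsetP[y yT ->].
  have := yT; rewrite !inE => /andP[yS /eqP ly].
  apply/andP; split.
    apply/imsetP; exists (x, y) => //; rewrite inE.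
    by apply: clique_level; rewrite ?ly ?(eq_sym x) ?yx //; move: xK; rewrite inE => /eqP.
  apply/cards1P; exists x; apply/setP => z; rewrite !inE.
  case: (eqVneq z x) => [->|_] /=; first by rewrite xS.
  by case: (eqVneq z y) => [->|//]; rewrite (negPf yS).
move/subset_leq_card; rewrite card_in_imset // b2; move: cT; lia.
Qed.

Lemma chain_min_uncovered : (s <= min_uncovered d G)%N.
Proof.
rewrite /min_uncovered; apply: (big_ind (fun k => s <= k)%N).
- by rewrite -[leqLHS]card_end_clique max_card.
- by move=> a b; rewrite leq_min => -> ->.
move=> P /andP[_ /forall_inP bP]; rewrite -[leqLHS]card_end_clique subset_leq_card //.
apply/fintype.subsetP => x xK; rewrite inE; apply/bigcupP => -[S SP xS].
by have /pred0P/(_ x) := bridged_copy_end_clique (bP S SP); rewrite /= xS xK.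
Qed.

End Chain.

(** * Energy and mass of the test function *)

Section Trigonometry.
Variable R : realType.
Implicit Types x y u : R.


Lemma sin_sub_mean x y : x <= y ->
  exists2 c, x <= c <= y & sin y - sin x = cos c * (y - x).
Proof.
move=> le_xy; have [c cI ->] := MVT_segment le_xy (fun z _ => is_derive_sin z)
  (continuous_subspaceT (@continuous_sin R)).
by exists c => //; rewrite in_itv in cI.
Qed.

Lemma cos_sub_mean x y : x <= y ->
  exists2 c, x <= c <= y & cos y - cos x = - sin c * (y - x).
Proof.
move=> le_xy; have [c cI ->] := MVT_segment le_xy (fun z _ => is_derive_cos z)
  (continuous_subspaceT (@continuous_cos R)).
by exists c => //; rewrite in_itv in cI.
Qed.

Lemma normr_cos_sub_le x y : `|cos x - cos y| <= `|x - y|.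
Proof.
wlog le_yx : x y / y <= x => [hw|].
  by case: (leP y x) => [/hw //|/ltW/hw]; rewrite distrC (distrC y).
have [c _ ->] := cos_sub_mean le_yx.
by rewrite normrM normrN ler_piMl // sin_max.
Qed.

Lemma normr_sin_le x : `|sin x| <= `|x|.
Proof.
wlog x0 : x / 0 <= x => [hw|].
  case: (leP 0 x) => [/hw //|/ltW]; rewrite -oppr_ge0 => /hw.
  by rewrite sinN !normrN.
have [c _] := sin_sub_mean x0; rewrite sin0 !subr0 => ->.
by rewrite normrM ler_piMl // cos_max.
Qed.

Lemma sqr_sin_le x : sin x ^+ 2 <= x ^+ 2.
Proof.
rewrite -real_normK ?num_real // -(@real_normK _ x) ?num_real //.
by rewrite lerXn2r ?nnegrE // normr_sin_le.
Qed.

Lemma cos_ge x : 1 - x ^+ 2 / 2 <= cos x.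
Proof.
have -> : x = (x / 2) *+ 2 by rewrite -mulr_natr divfK.
rewrite cos_mulr2n cos2sin2.
have : sin (x / 2) ^+ 2 <= (x / 2) ^+ 2.
  exact: sqr_sin_le.
by set t := sin _; move=> h; rewrite -mulr_natr; lra.
Qed.

(** The sum-to-product formula; the last factor is the squared cosine at the midpoint. Keeping it
    preserves the sharp constant in the energy, which a Lipschitz bound would lose. *)
Lemma sqr_sin_sub_le x y :
  (sin y - sin x) ^+ 2 <= (y - x) ^+ 2 * ((1 + cos (x + y)) / 2).
Proof.
pose a := (x + y) / 2; pose b := (y - x) / 2.
have -> : sin y - sin x = 2 * cos a * sin b.
  have -> : sin y = sin (a + b) by congr sin; rewrite /a /b; lra.
  have -> : sin x = sin (a - b) by congr sin; rewrite /a /b; lra.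
  by rewrite sinD sinB; ring.
have -> : x + y = a *+ 2 by rewrite /a -mulr_natr; lra.
rewrite cos_mulr2n; have -> : y - x = 2 * b by rewrite /b; lra.
have /(ler_wpM2l (sqr_ge0 (2 * cos a))) h := sqr_sin_le b.
rewrite !exprMn; rewrite !exprMn in h; apply: le_trans h _.
by rewrite le_eqVlt; apply/orP; left; apply/eqP; field.
Qed.

Lemma sin_sub_ge x u : 0 <= u ->
  2 * u * cos x - 2 * u ^+ 2 <= sin (x + u) - sin (x - u).
Proof.
move=> u0; have le2 : x - u <= x + u by lra.
have [c /andP[c1 c2] ->] := sin_sub_mean le2.
have := normr_cos_sub_le c x.
have : `|c - x| <= u by rewrite ler_norml; lra.
move=> h1 /le_trans/(_ h1); rewrite ler_norml => /andP[h2 _].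
have : 0 <= u * (cos c - cos x + u) by apply: mulr_ge0 => //; lra.
have -> : x + u - (x - u) = 2 * u by lra.
by nra.
Qed.

End Trigonometry.

(** * Sums over the blocks of the chain *)

Lemma sum_triples (V : nmodType) (H : nat -> V) m :
  \sum_(l < 3 * m) H l =
  \sum_(j < m) (H (3 * j)%N + H (3 * j).+1 + H (3 * j).+2).
Proof.
elim: m => [|m IHm]; first by rewrite muln0 !big_ord0.
have -> : (3 * m.+1 = (3 * m).+3)%N by lia.
by rewrite !big_ord_recr /= IHm !addrA.
Qed.

Section TestFunction.
Variables (R : realType) (d m s : nat).
Hypotheses (d_ge3 : (3 <= d)%N) (m_gt0 : (0 < m)%N) (s_ge : (d <= s)%N).
Local Notation w := (chain_weight d m s).
Local Notation D := (d%:R : R).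

Let pred_d : d.-1%:R = D - 1.
Proof. by rewrite -subn1 natrB //; lia. Qed.

Lemma sum_left_weight (H : nat -> R) :
  \sum_(j < m) (w (3 * j)%N)%:R * H j =
  (D - 1) * (\sum_(j < m) H j) + (s%:R - (D - 1)) * H 0%N.
Proof.
rewrite -(prednK m_gt0) !big_ord_recl chain_weight3 /=.
under eq_bigr => j _.
  rewrite chain_weight3 /bump /= add1n.
  rewrite eqSS (ltn_eqF (ltn_ord j)) /=.
  rewrite pred_d; over.
by rewrite -mulr_sumr /bump /=; ring.
Qed.

Lemma sum_right_weight (H : nat -> R) :
  \sum_(j < m) (w (3 * j.+1)%N)%:R * H j =
  (D - 1) * (\sum_(j < m) H j) + (s%:R - (D - 1)) * H m.-1.
Proof.
rewrite -(prednK m_gt0) !big_ord_recr /= chain_weight3 eqxx orbT.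
under eq_bigr => j _.
  rewrite chain_weight3 eqSS (ltn_eqF (ltn_ord j)) /=.
  rewrite pred_d; over.
by rewrite -mulr_sumr; ring.
Qed.

(** The excess [s - (d - 1)] of each clique is split off as a point mass, leaving a periodic
    chain. *)
Lemma sum_chain_weight (H : nat -> R) :
  \sum_(l < (3 * m).+1) (w l)%:R * H l =
  \sum_(j < m) ((D - 1) * H (3 * j)%N + H (3 * j).+1 + H (3 * j).+2)
  + (D - 1) * H (3 * m)%N + (s%:R - (D - 1)) * (H 0%N + H (3 * m)%N).
Proof.
rewrite big_ord_recr /= (sum_triples (fun l => (w l)%:R * H l)) /=.
rewrite chain_weight3 eqxx orbT.
under eq_bigr => j _ do rewrite chain_weight31 chain_weight32 !mul1r.
rewrite !big_split /= (sum_left_weight (fun j => H (3 * j)%N)) muln0.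
by rewrite -mulr_sumr; ring.
Qed.

Lemma sum_chain_edges (H : nat -> R) :
  \sum_(l < 3 * m) (w l * w l.+1)%:R * H l =
  \sum_(j < m) ((D - 1) * H (3 * j)%N + H (3 * j).+1 + (D - 1) * H (3 * j).+2)
  + (s%:R - (D - 1)) * (H 0%N + H (3 * m).-1).
Proof.
rewrite (sum_triples (fun l => (w l * w l.+1)%:R * H l)) /=.
under eq_bigr => j _.
  rewrite (_ : (3 * j).+3 = 3 * j.+1)%N; last by lia.
  rewrite chain_weight31 chain_weight32 !muln1 mul1n mul1r; over.
rewrite !big_split /= (sum_left_weight (fun j => H (3 * j)%N)) muln0.
rewrite (sum_right_weight (fun j => H (3 * j).+2)).
rewrite (_ : (3 * m.-1).+2 = (3 * m).-1); last by lia.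
by rewrite -!mulr_sumr; ring.
Qed.

Lemma card_chain :
  #|chain d m s|%:R = (D + 1) * m%:R + (2 * s%:R - (D - 1)) :> R.
Proof.
rewrite card_level_graph natr_sum.
have /= := sum_chain_weight (fun=> 1); under eq_bigr do rewrite mulr1.
by move=> ->; rewrite sumr_const card_ord -[_ *+ m]mulr_natr; ring.
Qed.

(* The effective resistance from the left end, multiplied by d - 1: a bridge
   counts d - 1, and each half of a copy of L_d counts 1. *)
Definition position (l : nat) : nat :=
  (l %/ 3 * d.+1 + nth 0 [:: 0; 1; d] (l %% 3))%N.

Lemma position3 j : (position (3 * j))%:R = (D + 1) * j%:R :> R.
Proof.
by rewrite /position mulKn // modnMr addn0 natrM -addn1 natrD mulrC.
Qed.

Lemma position31 j : (position (3 * j).+1)%:R = (D + 1) * j%:R + 1 :> R.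
Proof.
rewrite /position -(addn1 (3 * j)%N) (mulnC 3) divnMDl // modnMDl addn0 natrD natrM.
by rewrite -(addn1 d) natrD mulrC.
Qed.

Lemma position32 j : (position (3 * j).+2)%:R = (D + 1) * j%:R + D :> R.
Proof.
rewrite /position -(addn2 (3 * j)%N) (mulnC 3) divnMDl // modnMDl addn0 natrD natrM.
by rewrite -(addn1 d) natrD mulrC.
Qed.

Lemma position_rev l : (l <= 3 * m)%N ->
  (position (3 * m - l))%:R = (D + 1) * m%:R - (position l)%:R :> R.
Proof.
move=> lel; have := divn_eq l 3; have := ltn_pmod l (isT : (0 < 3)%N).
set j := (l %/ 3)%N => r3 e.
have : [|| l == (3 * j)%N, l == (3 * j).+1 | l == (3 * j).+2] by lia.
case/or3P => /eqP el; rewrite {}el in lel *.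
- rewrite -mulnBr !position3 natrB; first by ring.
  by lia.
- have -> : (3 * m - (3 * j).+1 = (3 * (m - j.+1)).+2)%N by lia.
  rewrite position31 position32 natrB; last by lia.
  by rewrite -(addn1 j) natrD; ring.
have -> : (3 * m - (3 * j).+2 = (3 * (m - j.+1)).+1)%N by lia.
rewrite position31 position32 natrB; last by lia.
by rewrite -(addn1 j) natrD; ring.
Qed.

Variable k : R.
Hypothesis k_gt0 : 0 < k.

Definition half_length : R := (D + 1) * m%:R / 2.
Local Notation L := half_length.

(** Centred at the midpoint, hence odd under reversal of the chain and of sum zero. The frequency
    [k] stays free until the vertex count is brought in. *)
Definition test_function (l : nat) : R := sin (k * ((position l)%:R - L)).
Local Notation F := test_function.

Lemma test_function_rev l : (l <= 3 * m)%N -> F (3 * m - l)%N = - F l.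
Proof.
by move=> lel; rewrite /F position_rev // -sinN; congr sin; rewrite /half_length; field.
Qed.

Lemma sum_test_function : \sum_(x : chain d m s) F (level x) = 0.
Proof.
rewrite (sum_level xpredT F).
have rev : \sum_(l < (3 * m).+1) F l *+ w l = - \sum_(l < (3 * m).+1) F l *+ w l.
  rewrite -sumrN [LHS](reindex_inj rev_ord_inj) /=; apply: eq_bigr => l _.
  have lel := ltn_ord l; rewrite ltnS in lel.
  rewrite subSS test_function_rev // mulNrn; congr (- (_ *+ _)).
  rewrite /chain_weight.
  have -> : ((3 * m - l) %% 3 == 0)%N = (l %% 3 == 0)%N by lia.
  have -> : (3 * m - l == 0)%N = (l == 3 * m :> nat)%N by lia.
  have -> : (3 * m - l == 3 * m)%N = (l == 0 :> nat)%N by lia.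
  by rewrite orbC.
by apply/eqP; move/eqP: rev; rewrite -addr_eq0 -mulr2n mulrn_eq0.
Qed.

(** The centred position of the midpoint of the bridge between levels 3j+1 and 3j+2; all phases in a
    block are compared with the one there. *)
Let q (j : nat) : R := (D + 1) * (j%:R + 1 / 2) - L.
Definition cosine_sum : R := \sum_(j < m) cos (2 * k * q j).
Local Notation T := cosine_sum.

(** A Riemann sum of the cosine, compared with telescoping differences of the sine. An upper bound
    suffices, as [T] raises the energy and lowers the mass. *)
Lemma sum_cos_le : k * (D + 1) * T <= sin (2 * k * L) + m%:R * (k * (D + 1)) ^+ 2.
Proof.
set u := k * (D + 1).
have u0 : 0 <= u by rewrite mulr_ge0 ?(ltW k_gt0) // addr_ge0.
pose b j := sin (2 * k * ((D + 1) * j%:R - L)).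
have tele : \sum_(j < m) (b j.+1 - b j) = 2 * sin (2 * k * L).
  rewrite -(big_mkord xpredT (fun j => b j.+1 - b j)) telescope_sumr // /b.
  rewrite mulr0 sub0r mulrN sinN opprK.
  have -> : (D + 1) * m%:R - L = L by rewrite /half_length; field.
  by ring.
have : \sum_(j < m) (2 * u * cos (2 * k * q j) - 2 * u ^+ 2)
    <= \sum_(j < m) (b j.+1 - b j).
  apply: ler_sum => j _; apply: le_trans (sin_sub_ge _ u0) _.
  rewrite /b /q /u -(addn1 j) natrD le_eqVlt; apply/orP; left; apply/eqP.
  by congr (sin _ - sin _); field.
rewrite tele sumrB -mulr_sumr -/cosine_sum sumr_const card_ord -[_ *+ m]mulr_natr.
by lra.
Qed.

Let cos_shift (x y h c : R) : x = y + h -> `|h| <= c -> cos x <= cos y + c.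
Proof.
move=> -> hc; have := normr_cos_sub_le (y + h) y.
by rewrite addrAC subrr add0r ler_norml => /andP[_]; lra.
Qed.

Let D3 : 3 <= D. Proof. by rewrite ler_nat. Qed.
Let sD : D <= s%:R. Proof. by rewrite ler_nat. Qed.

(** In a block the steps 1, d - 1, 1 carry d - 1, 1, d - 1 edges, so the squared steps add up to (d
    - 1)(d + 1). The bridge has the phase of [q j] exactly; the other two steps are off by [k * D].
    The last line is the clique excess on the two outermost steps. *)
Lemma test_function_energy :
  \sum_(l < 3 * m) (w l * w l.+1)%:R * (F l.+1 - F l) ^+ 2 <=
  k ^+ 2 * (D - 1) * ((D + 1) / 2 * (m%:R + T) + m%:R * k * D)
  + (s%:R - (D - 1)) * (k ^+ 2 * (1 + cos (2 * k * L) + k)).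
Proof.
have k0 := ltW k_gt0; have hD := D3; have hs := sD.
rewrite (sum_chain_edges (fun l => (F l.+1 - F l) ^+ 2)); apply: lerD; last first.
  apply: ler_wpM2l; first by lra.
  have pm : (position (3 * m).-1)%:R = (D + 1) * m%:R - 1.
    rewrite -subn1 position_rev; last by lia.
    by rewrite (position31 0) mulr0 add0r.
  have bnd l : position l.+1 = (position l).+1 :> nat ->
     cos (k * ((position l)%:R - L) + k * ((position l.+1)%:R - L)) <=
       cos (2 * k * L) + k ->
     (F l.+1 - F l) ^+ 2 <= k ^+ 2 * ((1 + cos (2 * k * L) + k) / 2).
    move=> e h; apply: le_trans (sqr_sin_sub_le _ _) _.
    rewrite -mulrBr e -(addn1 (position l)) natrD.
    have -> : (position l)%:R + 1 - L - ((position l)%:R - L) = 1 by ring.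
    rewrite mulr1 ler_wpM2l ?sqr_ge0 //.
    rewrite e -(addn1 (position l)) natrD in h.
    by lra.
  have -> : k ^+ 2 * (1 + cos (2 * k * L) + k) =
      k ^+ 2 * ((1 + cos (2 * k * L) + k) / 2) + k ^+ 2 * ((1 + cos (2 * k * L) + k) / 2).
    by field.
  apply: lerD; apply: bnd => //.
  - rewrite -[cos (2 * k * L)]cosN; apply: (cos_shift (h := k)).
      by rewrite (position31 0) (position3 0); ring.
    by rewrite ger0_norm.
  - have -> : (3 * m).-1.+1 = (3 * m)%N by lia.
    by apply/eqP; rewrite -(eqr_nat R) -[X in _ == X%:R]addn1 natrD pm position3 subrK.
  apply: (cos_shift (h := - k)); last by rewrite normrN ger0_norm.
  have -> : (3 * m).-1.+1 = (3 * m)%N by lia.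
  by rewrite pm position3 /half_length; field.
rewrite [leRHS](_ : _ = \sum_(j < m) (k ^+ 2 * (D - 1) *
    ((D + 1) / 2 * (1 + cos (2 * k * q j)) + k * D))); last first.
  rewrite -mulr_sumr big_split /= -mulr_sumr big_split /= !sumr_const card_ord.
  by rewrite -[_ *+ m]mulr_natr -[1 *+ m]mulr_natr /cosine_sum; ring.
apply: ler_sum => j _; set c := cos _.
have e1 : (F (3 * j).+1 - F (3 * j)%N) ^+ 2 <= k ^+ 2 * ((1 + c + k * D) / 2).
  apply: le_trans (sqr_sin_sub_le _ _) _; rewrite -mulrBr position31 position3.
  rewrite [X in X ^+ 2](_ : _ = k); last by ring.
  rewrite ler_wpM2l ?sqr_ge0 //; set c' := cos (_ + _).
  suff : c' <= c + k * D by lra.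
  apply: (cos_shift (h := - (k * D))); last by rewrite normrN ger0_norm ?mulr_ge0.
  by rewrite /q; field.
have e2 : (F (3 * j).+2 - F (3 * j).+1) ^+ 2 <= k ^+ 2 * ((D - 1) ^+ 2 * ((1 + c) / 2)).
  apply: le_trans (sqr_sin_sub_le _ _) _; rewrite -mulrBr position31 position32.
  rewrite le_eqVlt; apply/orP; left; apply/eqP; rewrite /c.
  rewrite [X in cos X](_ : _ = 2 * k * q j); last by rewrite /q; field.
  by ring.
have e3 : (F (3 * j).+3 - F (3 * j).+2) ^+ 2 <= k ^+ 2 * ((1 + c + k * D) / 2).
  apply: le_trans (sqr_sin_sub_le _ _) _.
  rewrite (_ : (3 * j).+3 = 3 * j.+1)%N; last by lia.
  rewrite -mulrBr position32 position3 -(addn1 j) natrD.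
  rewrite [X in X ^+ 2](_ : _ = k); last by ring.
  rewrite ler_wpM2l ?sqr_ge0 //; set c' := cos (_ + _).
  suff : c' <= c + k * D by lra.
  apply: (cos_shift (h := k * D)); last by rewrite ger0_norm ?mulr_ge0.
  by rewrite /q; field.
have D1 : 0 <= D - 1 by lra.
have := ler_wpM2l D1 e1; have := ler_wpM2l D1 e3.
set E1 := _ ^+ 2 in e1 *; set E3 := (_ - _) ^+ 2 in e3 *.
set K2 := k ^+ 2 in e1 e2 e3 *.
move=> f3 f1; apply: le_trans (lerD (lerD f1 e2) f3) _.
by rewrite le_eqVlt; apply/orP; left; apply/eqP; field.
Qed.

(** A block has d + 1 vertices, all with phases within [k * (D + 1)] of that of [q j]. The blocks
    omit level 3m, so the end masses total [2 * s - (d - 1)]; both ends have the same squared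
    value. *)
Lemma test_function_mass :
  (D + 1) / 2 * (m%:R - T) - m%:R * k * (D + 1) ^+ 2 / 2
  + (2 * s%:R - (D - 1)) * ((1 - cos (2 * k * L)) / 2)
  <= \sum_(x : chain d m s) F (level x) ^+ 2.
Proof.
have k0 := ltW k_gt0; have hD := D3; have hs := sD.
rewrite (sum_level xpredT (fun l => F l ^+ 2)).
under eq_bigr do rewrite -mulr_natl.
rewrite (sum_chain_weight (fun l => F l ^+ 2)).
have sq (x : R) : sin x ^+ 2 = (1 - cos (2 * x)) / 2.
  by rewrite mulr_natl cos_mulr2n cos2sin2; field.
have Fend l : k * ((position l)%:R - L) = k * L \/ k * ((position l)%:R - L) = - (k * L) ->
   F l ^+ 2 = (1 - cos (2 * k * L)) / 2.
  rewrite /F sq -(mulrA 2 k) => -[->|->] //.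
  by rewrite mulrN cosN.
rewrite (Fend 0%N); last by right; rewrite (position3 0); ring.
rewrite (Fend (3 * m)%N); last by left; rewrite position3 /half_length; field.
set c0 := cos (2 * k * L).
rewrite -[leRHS]addrA lerD //; last by rewrite le_eqVlt; apply/orP; left; apply/eqP; field.
rewrite [leLHS](_ : _ = \sum_(j < m)
    ((D + 1) * ((1 - (cos (2 * k * q j) + k * (D + 1))) / 2))); last first.
  rewrite -mulr_sumr -mulr_suml sumrB big_split /= !sumr_const card_ord.
  by rewrite -[_ *+ m]mulr_natr -[1 *+ m]mulr_natr -/cosine_sum; field.
apply: ler_sum => j _; set c := cos _.
have bnd l h : 2 * (k * ((position l)%:R - L)) = 2 * k * q j + k * h ->
    `|h| <= D + 1 -> (1 - (c + k * (D + 1))) / 2 <= F l ^+ 2.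
  move=> e hh; rewrite /F sq ler_pM2r ?invr_gt0 // lerB //.
  by apply: (cos_shift e); rewrite normrM (ger0_norm k0) ler_wpM2l.
have b0 := bnd (3 * j)%N (- (D + 1)).
have b1 := bnd (3 * j).+1 (- (D - 1)).
have b2 := bnd (3 * j).+2 (D - 1).
have {}b0 : (1 - (c + k * (D + 1))) / 2 <= F (3 * j)%N ^+ 2.
  apply: b0; first by rewrite position3 /q; field.
  by rewrite normrN ger0_norm //; lra.
have {}b1 : (1 - (c + k * (D + 1))) / 2 <= F (3 * j).+1 ^+ 2.
  apply: b1; first by rewrite position31 /q; field.
  by rewrite normrN ger0_norm //; lra.
have {}b2 : (1 - (c + k * (D + 1))) / 2 <= F (3 * j).+2 ^+ 2.
  apply: b2; first by rewrite position32 /q; field.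
  by rewrite ger0_norm //; lra.
have D1 : 0 <= D - 1 by lra.
have := ler_wpM2l D1 b0; lra.
Qed.

End TestFunction.

(** * The estimates *)

Lemma chain_connectivity (R : realType) (d t : nat) :
  (3 <= d)%N -> (d + 4 <= t)%N ->
  #|chain d (t ^ 4) (t ^ 3)|%:R ^+ 2 *
    algebraic_connectivity R (chain d (t ^ 4) (t ^ 3))
  <= (d%:R - 1) * pi ^+ 2 + 160 * (d%:R - 1) / t%:R ^+ 3.
Proof.
move=> d3 dt.
have t0 : (0 < t)%N by lia.
have m0 : (0 < t ^ 4)%N by rewrite expn_gt0 t0.
have ds : (d <= t ^ 3)%N.
  by rewrite (leq_trans _ (leq_pexp2l t0 (isT : 1 <= 3)%N)) // expn1; lia.
set D : R := d%:R; set t' : R := t%:R.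
set n : R := #|_|%:R.
have nE := card_chain R d3 m0 ds; rewrite -/n -/D !natrX -/t' in nE.
(* By [nE], [n] is the chain length plus [2 * a]: each clique replaces a piece of string of length
   [a]. *)
pose a : R := t' ^+ 3 - (D - 1) / 2.
have D3 : 3 <= D by rewrite ler_nat.
have t4 : D + 4 <= t' by rewrite -natrD ler_nat.
have tp : 0 < t' by lra.
have tp0 := ltW tp.
have D1 : 0 <= D - 1 by lra.
have D1' : 1 <= D - 1 by lra.
have Dp : 0 <= D + 1 by lra.
have t2 : 49 <= t' ^+ 2 by rewrite expr2; nra.
have t3D : D <= t' ^+ 3 by rewrite exprSr; nra.
have t4t : t' ^+ 4 = t' ^+ 3 * t' by rewrite exprSr.
have t3t : t' ^+ 3 = t' ^+ 2 * t' by rewrite exprSr.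
have a0 : 0 <= a by rewrite /a; lra.
have a_le : a <= t' ^+ 3 by rewrite /a; lra.
have n_gt0 : 0 < n by rewrite nE; nra.
have pi4 : pi <= 4 :> R by have := pihalf_lt2 R; lra.
have pi0 : 0 < pi :> R := pi_gt0 R.
(* Half a wave fits a string of length [n]; on the chain, the phase [th = k * a] is missing at each
   end. *)
pose k : R := pi / n.
have k0 : 0 < k by rewrite divr_gt0.
have kn : k * n = pi by rewrite divfK // gt_eqF.
pose th := k * a.
pose m : R := t' ^+ 4.
have kX : 2 * k * half_length R d (t ^ 4) = pi - th *+ 2.
  by rewrite /half_length natrX -/D -/t' -kn nE /th /a -mulr_natr; field.
have cX : cos (2 * k * half_length R d (t ^ 4)) = - cos (th *+ 2).
  by rewrite kX cosB cospi sinpi; ring.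
have sX : sin (2 * k * half_length R d (t ^ 4)) = sin (th *+ 2).
  by rewrite kX sinB cospi sinpi; ring.
have th0 : 0 <= th by rewrite mulr_ge0 // ltW.
have kmD : k * (D + 1) * m <= 4.
  by rewrite (le_trans _ pi4) // -kn nE /m -mulrA ler_pM2l //; lra.
have tht : th * t' <= 1.
  have : k * ((D + 1) * t' ^+ 4) <= 4 by rewrite mulrA.
  have : k * (4 * (a * t')) <= k * ((D + 1) * t' ^+ 4).
    by rewrite ler_pM2l // t4t; nra.
  by rewrite /th; nra.
have th1 : th <= 1 by nra.
have E := test_function_energy d3 m0 ds k0.
have M := test_function_mass d3 m0 ds k0.
have S := sum_cos_le d (t ^ 4) k0.
rewrite cX !natrX -/t' -/m -/D in E M; rewrite sX natrX -/t' -/m -/D in S.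
set T : R := cosine_sum _ _ _ in E M S.
set c := cos (th *+ 2) in E M.
(* M0 and k^2 (D - 1) Q bound the mass and the energy of the test function.  Both
   end cliques shift its phase by th, and the terms of Q - M0 of first order in
   th cancel for this choice of k. *)
pose M0 := (D + 1) / 2 * (m - T) - m * k * (D + 1) ^+ 2 / 2
  + (2 * t' ^+ 3 - (D - 1)) * ((1 - - c) / 2).
pose Q := (D + 1) / 2 * (m + T) + m * k * D + a * (2 * th ^+ 2 + k).
have c_ge : 1 - c <= 2 * th ^+ 2.
  have := cos_ge (th *+ 2); rewrite -/c -mulr_natr; lra.
have c_ge1 : 0 <= 1 + c by have := cos_geN1 (th *+ 2); rewrite -/c; lra.
pose P := k * (D + 1) * m.
have DP : (D + 1) * P <= (D + 1) * 4 by rewrite ler_wpM2l.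
have hT : (D + 1) * T <= 2 * a + (D + 1) * P.
  rewrite -(ler_pM2l k0) mulrA (le_trans S) //.
  have : sin (th *+ 2) <= th *+ 2.
    rewrite (le_trans (ler_norm _)) // (le_trans (normr_sin_le _)) //.
    by rewrite ger0_norm // mulrn_wge0.
  rewrite -mulr_natr /P => h.
  rewrite [leRHS](_ : _ = th * 2 + m * (k * (D + 1)) ^+ 2) ?lerD2r //.
  by rewrite /th; ring.
have M0E : M0 = (D + 1) * m / 2 - (D + 1) * T / 2 - (D + 1) * P / 2 + a * (1 + c).
  by rewrite /M0 /P /a; field.
have m_ge : 7 * t' ^+ 3 <= m by rewrite /m t4t mulrC ler_wpM2l ?exprn_ge0 //; lra.
have t3_ge : 49 * t' <= t' ^+ 3 by rewrite t3t ler_wpM2r //; lra.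
have D4 : 4 <= D + 1 by lra.
have Dm : 4 * m <= (D + 1) * m by rewrite ler_wpM2r ?exprn_ge0.
have M0_ge : m <= M0.
  have : 0 <= a * (1 + c) by rewrite mulr_ge0.
  by rewrite M0E; lra.
(* The cubic error: [a <= t' ^+ 3], while [th <= 1 / t']. *)
have ath : a * th ^+ 2 <= t'.
  have th_sq : (th * t') ^+ 2 <= 1 by rewrite expr_le1 // mulr_ge0.
  apply: (@le_trans _ _ (t' ^+ 3 * th ^+ 2)); first by rewrite ler_wpM2r // sqr_ge0.
  rewrite (_ : t' ^+ 3 * th ^+ 2 = t' * (th * t') ^+ 2); last by ring.
  by rewrite ler_piMr.
(* The bound [2 * a] from [hT] cancels against [a * (1 + c)]. What is left is at most [4 * t'] from
   [ath] and [6 * (D + 1) + 5] from discretisation, which [D + 4 <= t'] absorbs. *)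
have QM : Q - M0 <= 10 * t'.
  have mk0 : 0 <= m * k by rewrite mulr_ge0 ?ltW // exprn_gt0.
  have QE : Q = (D + 1) * m / 2 + (D + 1) * T / 2 + P - m * k + 2 * (a * th ^+ 2) + th.
    by rewrite /Q /P /th; field.
  have : a * (1 - c) <= a * (2 * th ^+ 2) by rewrite ler_wpM2l.
  rewrite QE M0E /P in kmD DP hT *; lra.
(* The end terms lack the factor [D - 1]; as it is at least 1, they may be moved into [Q]. *)
have E' : \sum_(l < 3 * t ^ 4) (chain_weight d (t ^ 4) (t ^ 3) l *
      chain_weight d (t ^ 4) (t ^ 3) l.+1)%:R *
      (test_function d (t ^ 4) k l.+1 - test_function d (t ^ 4) k l) ^+ 2
    <= k ^+ 2 * (D - 1) * Q.
  apply: le_trans E _; rewrite [leRHS]mulrDr lerD //.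
  rewrite (_ : _ * (a * _) = k ^+ 2 * ((D - 1) * (a * (2 * th ^+ 2 + k)))); last by ring.
  rewrite mulrCA ler_wpM2l ?sqr_ge0 //.
  have h1 : t' ^+ 3 - (D - 1) <= a by rewrite /a; lra.
  have h2 : 1 - c + k <= 2 * th ^+ 2 + k by rewrite lerD2r.
  have h0 : 0 <= 1 - c + k by have := cos_le1 (th *+ 2); rewrite -/c; lra.
  apply: (@le_trans _ _ (a * (2 * th ^+ 2 + k))).
    by apply: ler_pM => //; rewrite subr_ge0; apply: le_trans t3D; rewrite gerBl.
  rewrite ler_peMl //.
  by rewrite mulr_ge0 // addr_ge0 ?(ltW k0) // mulr_ge0 // sqr_ge0.
set K := (D - 1) * pi ^+ 2 + _.
have eps0 : 0 <= 160 * (D - 1) / t' ^+ 3.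
  by rewrite divr_ge0 ?exprn_ge0 // mulr_ge0.
have K0 : 0 <= K.
  by rewrite addr_ge0 // mulr_ge0 ?sqr_ge0.
have m_gt0 : 0 < m by rewrite exprn_gt0.
have M_gt0 : 0 < \sum_(x : chain d (t ^ 4) (t ^ 3)) test_function d (t ^ 4) k (level x) ^+ 2.
  exact: lt_le_trans (lt_le_trans m_gt0 M0_ge) M.
(* The constant 160 is 16 times 10, from [pi <= 4] and [QM]; [M0 >= t' ^+ 4] turns the excess of
   order [t'] into a relative error of order [1 / t' ^+ 3]. *)
have KQ : (D - 1) * pi ^+ 2 * Q <= K * M0.
  rewrite /K [leRHS]mulrDl -lerBlDl -mulrBr.
  apply: (@le_trans _ _ ((D - 1) * 16 * (10 * t'))).
    apply: (@le_trans _ _ ((D - 1) * pi ^+ 2 * (10 * t'))).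
      by rewrite ler_wpM2l // mulr_ge0 ?sqr_ge0.
    rewrite ler_wpM2r //; first by rewrite mulr_ge0.
    rewrite ler_wpM2l //.
    by rewrite expr2 (_ : 16 = 4 * 4) ?ler_pM // ?ltW //; ring.
  apply: (@le_trans _ _ (160 * (D - 1) / t' ^+ 3 * m)); last by rewrite ler_wpM2l.
  rewrite /m t4t [leRHS]mulrA divfK; last by rewrite gt_eqF // exprn_gt0.
  by rewrite le_eqVlt; apply/orP; left; apply/eqP; ring.
have n2 : 0 < n ^+ 2 by rewrite exprn_gt0.
rewrite mulrC -ler_pdivlMr //.
apply: (algebraic_connectivity_le
  (f := fun x : chain d (t ^ 4) (t ^ 3) => test_function d (t ^ 4) k (level x))).
- by rewrite divr_ge0 // ltW.
- by have := sum_test_function d3 m0 ds k0.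
- apply: contrapT => nex; move: M_gt0; rewrite big1 ?ltxx // => x _.
  by apply/eqP; rewrite sqrf_eq0; apply: contrapT => /negP h; apply: nex; exists x.
rewrite energy_level_graph ler_pMn2r // (le_trans E') //.
apply: (@le_trans _ _ (K / n ^+ 2 * M0)); last by rewrite ler_wpM2l // divr_ge0 // ltW.
rewrite [leRHS]mulrAC ler_pdivlMr // (le_trans _ KQ) //.
by rewrite -kn le_eqVlt; apply/orP; left; apply/eqP; ring.
Qed.

(** * Divergence of the two defect ratios *)

Local Open Scope classical_set_scope.
Local Open Scope ring_scope.

Lemma cvgy_ge_powR (R : realType) (x : nat -> R) (c q : R) (j : nat) :
  0 < c -> 0 < q -> (forall i, c * (i + j)%:R `^ q <= x i) ->
  x i @[i --> \oo] --> +oo.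
Proof.
move=> c0 q0 x_ge; apply/cvgryPge => A.
pose B := (Num.max A 0 / c) `^ q^-1.
near=> i.
have Bi : B <= (i + j)%:R.
  apply: (@le_trans _ _ i%:R); last by rewrite ler_nat leq_addr.
  by near: i; exact: nbhs_infty_ger.
apply: le_trans (x_ge i).
rewrite mulrC -ler_pdivrMr //.
apply: (@le_trans _ _ (Num.max A 0 / c)).
  by rewrite ler_pM2r ?invr_gt0 // le_max lexx.
have A0 : 0 <= Num.max A 0 / c by rewrite divr_ge0 ?le_max ?lexx ?orbT // ltW.
have -> : Num.max A 0 / c = B `^ q.
  by rewrite /B -powRrM mulVf ?powRr1 // gt_eqF.
by apply: ge0_ler_powR; rewrite ?nnegrE ?powR_ge0 // ltW.
Unshelve. all: by end_near. Qed.

Section Sequence.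
Variables (R : realType) (d : nat).
Hypothesis d_ge3 : (3 <= d)%N.
Local Notation D := (d%:R : R).

(** The shift by [d + 4] makes all size conditions hold from the first term on. *)
Definition chains (i : nat) : sgraph :=
  chain d ((i + (d + 4)) ^ 4) ((i + (d + 4)) ^ 3).

Definition gap (i : nat) : R := 160 * (D - 1) / (i + (d + 4))%:R ^+ 3.

Let D3 : 3 <= D. Proof. by rewrite ler_nat. Qed.

Let conds i (t := (i + (d + 4))%N) :
  [/\ (0 < t)%N, (2 <= t ^ 4)%N, (d <= t ^ 3)%N & (d + 4 <= t ^ 3)%N].
Proof.
have t0 : (0 < t)%N by rewrite /t; lia.
have t3 : (t <= t ^ 3)%N by rewrite -{1}(expn1 t) leq_pexp2l.
have t4 : (t <= t ^ 4)%N by rewrite -{1}(expn1 t) leq_pexp2l.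
have td : (d + 4 <= t)%N by rewrite leq_addl.
by split=> //; [apply: leq_trans t4|apply: leq_trans t3|apply: leq_trans t3]; lia.
Qed.

Lemma card_chains i (t := (i + (d + 4))%:R : R) :
  #|chains i|%:R = (D + 1) * t ^+ 4 + (2 * t ^+ 3 - (D - 1)) :> R.
Proof.
have [t0 m2 s1 s2] := conds i.
by rewrite /chains card_chain ?natrX //; apply: leq_trans m2.
Qed.

Lemma chains_connected i : connected_graph (chains i).
Proof. by have [t0 m2 s1 s2] := conds i; apply: chain_connected. Qed.

Lemma chains_min_degree i : min_degree (chains i) = d.
Proof. by have [t0 m2 s1 s2] := conds i; apply: chain_min_degree. Qed.

Lemma ltn_card_chains i j : (i < j)%N -> (#|chains i| < #|chains j|)%N.
Proof.
move=> ij; rewrite -(ltr_nat R) !card_chains.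
set a : R := (i + _)%:R; set b : R := (j + _)%:R.
have ab : a < b by rewrite ltr_nat ltn_add2r.
have a0 : 0 <= a by exact: ler0n.
have h4 : a ^+ 4 < b ^+ 4 by rewrite ltrXn2r ?nnegrE // (le_trans a0) // ltW.
have h3 : a ^+ 3 < b ^+ 3 by rewrite ltrXn2r ?nnegrE // (le_trans a0) // ltW.
have D1 : 0 < D + 1 by rewrite ltr_pwDr.
by rewrite -(ltr_pM2l D1) in h4; lra.
Qed.

Lemma gap_ge0 i : 0 <= gap i.
Proof. by have := D3 => h; rewrite divr_ge0 // mulr_ge0 //; lra. Qed.

Lemma cvg_gap : gap i @[i --> \oo] --> (0 : R).
Proof.
have hD := D3.
apply: (@squeeze_cvgr _ _ _ _ (fun=> 0) (fun i => 160 * (D - 1) * harmonic i)).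
- near=> i; rewrite gap_ge0 /= /gap ler_wpM2l //; first by lra.
  rewrite lef_pV2 ?posrE ?exprn_gt0 ?ltr0n //; last by lia.
  rewrite -natrX ler_nat -[leqLHS]expn1.
  by apply: leq_trans (leq_pexp2l _ (isT : 1 <= 3)%N); rewrite ?expn1; lia.
- exact: cvg_cst.
rewrite -[X in _ --> X](mulr0 (160 * (D - 1))).
by apply: cvgM; [exact: cvg_cst|exact: cvg_harmonic].
Unshelve. all: by end_near. Qed.

(** Since [n >= t ^+ 3], the summand [1 / n] does not exceed the order of [gap], so the denominator
    is of order at most [t] to the power 4 - 3p. A numerator of order [t ^+ 3] leaves the exponent
    3p - 1, positive by hypothesis. *)
Lemma chains_ratio_cvgy (p : R) (x : nat -> R) : 1 / 3 < p ->
  (forall i, (i + (d + 4))%:R ^+ 3 / (D + 1) <= x i) ->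
  x i / (#|chains i|%:R * (gap i + #|chains i|%:R^-1) `^ p) @[i --> \oo] --> +oo.
Proof.
move=> p_gt x_ge.
pose C := 160 * (D - 1) + 1.
have hD := D3.
have C0 : 0 < C by rewrite /C; lra.
have p0 : 0 <= p by lra.
apply: (@cvgy_ge_powR _ _ ((D + 1) * (D + 3) * C `^ p)^-1 (3 * p - 1) (d + 4)).
- by rewrite invr_gt0 !mulr_gt0 ?powR_gt0 //; lra.
- by lra.
move=> i; have := x_ge i; have nE := card_chains i.
rewrite /gap; set t : R := (i + (d + 4))%:R in nE * => {}x_ge.
have t7 : 7 <= t by rewrite ler_nat; lia.
have t0 : 0 < t by lra.
set n : R := #|_|%:R in nE *.
have t3 : 0 < t ^+ 3 by rewrite exprn_gt0.
have t3D : D - 1 <= t ^+ 3.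
  apply: (@le_trans _ _ t); first by rewrite lerBlDr natr1 ler_nat; lia.
  by rewrite -{1}(expr1 t) ler_weXn2l //; lra.
have t4t : t ^+ 4 = t ^+ 3 * t by rewrite exprSr.
have t34 : t ^+ 3 <= t ^+ 4 by rewrite t4t ler_peMr ?(ltW t3) //; lra.
have Dt : 4 * t ^+ 4 <= (D + 1) * t ^+ 4 by rewrite ler_wpM2r ?exprn_ge0 ?(ltW t0) //; lra.
have n_ge : t ^+ 3 <= n by rewrite nE; lra.
have n_gt0 : 0 < n by apply: lt_le_trans n_ge.
have n_le : n <= (D + 3) * t ^+ 4 by rewrite nE; lra.
have e_le : 160 * (D - 1) / t ^+ 3 + n^-1 <= C / t ^+ 3.
  by rewrite /C [leRHS]mulrDl mul1r lerD2l lef_pV2 ?posrE.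
have e_ge0 : 0 <= 160 * (D - 1) / t ^+ 3 + n^-1.
  by rewrite addr_ge0 ?invr_ge0 ?ltW // divr_gt0 // mulr_gt0 //; lra.
have t3p : (t ^+ 3) `^ p = t `^ (3 * p - 1) * t.
  rewrite -[X in _ * X]powRr1 ?(ltW t0) // -powRD ?(gt_eqF t0) ?implybT //.
  by rewrite subrK powRrM -powR_mulrn ?ltW.
have d_le : n * (160 * (D - 1) / t ^+ 3 + n^-1) `^ p <=
    (D + 3) * C `^ p * t ^+ 3 / t `^ (3 * p - 1).
  apply: (@le_trans _ _ ((D + 3) * t ^+ 4 * (C / t ^+ 3) `^ p)).
    apply: ler_pM => //; rewrite ?powR_ge0 ?(ltW n_gt0) //.
    by apply: ge0_ler_powR; rewrite ?nnegrE ?divr_ge0 ?(ltW C0) ?(ltW t3).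
  rewrite powRM ?invr_ge0 ?(ltW C0) ?(ltW t3) //.
  have -> : (t ^+ 3)^-1 `^ p = (t `^ (3 * p - 1) * t)^-1.
    by rewrite -powR_inv1 ?(ltW t3) // powRAC t3p powR_inv1 // mulr_ge0 ?powR_ge0 ?ltW.
  rewrite t4t.
  rewrite le_eqVlt; apply/orP; left; apply/eqP; field.
  by rewrite !gt_eqF ?powR_gt0.
set den := n * _ in d_le *.
have den_gt0 : 0 < den.
  rewrite mulr_gt0 ?powR_gt0 // addr_gt0 ?invr_gt0 // divr_gt0 // mulr_gt0 //; lra.
rewrite ler_pdivlMr //; apply: le_trans x_ge.
have D1 : 0 < D + 1 by lra.
have D3' : 0 < D + 3 by lra.
have y0 : 0 < t `^ (3 * p - 1) by rewrite powR_gt0.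
have Cp : 0 < C `^ p by rewrite powR_gt0.
apply: (le_trans (ler_wpM2l _ d_le)).
  by rewrite mulr_ge0 ?invr_ge0 ?ltW // !mulr_gt0.
rewrite le_eqVlt; apply/orP; left; apply/eqP; field.
by rewrite !gt_eqF.
Qed.

(** The diameter is at most 3m, while the cliques raise [n] above [(d + 1) * m] by
    [2 * s - (d - 1)], which is at least [s]. *)
Lemma chains_diam i :
  (i + (d + 4))%:R ^+ 3 / (D + 1) <=
  3 * #|chains i|%:R / (D + 1) - (diam (chains i))%:R.
Proof.
have [t0 m2 s1 s2] := conds i; have hD := D3.
rewrite card_chains; set t : R := (i + (d + 4))%:R.
have t3 : 0 <= t ^+ 3 by rewrite exprn_ge0.
have t3D : D <= t ^+ 3 by rewrite -natrX ler_nat.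
have : (diam (chains i))%:R <= 3 * t ^+ 4.
  by rewrite -natrX -natrM ler_nat; apply: chain_diam.
move=> /(lerB (lexx (3 * ((D + 1) * t ^+ 4 + (2 * t ^+ 3 - (D - 1))) / (D + 1)))).
apply: le_trans.
have -> : 3 * ((D + 1) * t ^+ 4 + (2 * t ^+ 3 - (D - 1))) / (D + 1) - 3 * t ^+ 4 =
    3 * (2 * t ^+ 3 - (D - 1)) / (D + 1) by field; lra.
by rewrite ler_pM2r ?invr_gt0; lra.
Qed.

Lemma chains_min_uncovered i :
  (i + (d + 4))%:R ^+ 3 / (D + 1) <= (min_uncovered d (chains i))%:R.
Proof.
have [t0 m2 s1 s2] := conds i; have hD := D3.
have := chain_min_uncovered d_ge3 m2 s2; rewrite -(ler_nat R) natrX; apply: le_trans.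
by rewrite ler_piMr ?exprn_ge0 // invf_le1; lra.
Qed.

End Sequence.

Theorem proposition3p22 (R : realType) (d : nat) (d_ge3 : (3 <= d)%N) :
  (forall p : R, 1 / 3 < p ->
    exists (G : nat -> sgraph) (eps : nat -> R),
      [/\ (forall k, connected_graph (G k) /\ min_degree (G k) = d),
          (forall i j, (i < j)%N -> (#|G i| < #|G j|)%N),
          (forall k, 0 <= eps k) /\ (eps k @[k --> \oo] --> (0 : R)),
          (forall k, #|G k|%:R ^+ 2 * algebraic_connectivity R (G k)
                       <= (d%:R - 1) * pi ^+ 2 + eps k)
        & ((3 * #|G k|%:R / (d%:R + 1) - (diam (G k))%:R)
             / (#|G k|%:R * (eps k + #|G k|%:R^-1) `^ p)
             @[k --> \oo] --> +oo)])
  /\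
  (forall p : R, 1 / 3 < p ->
    exists (G : nat -> sgraph) (eps : nat -> R),
      [/\ (forall k, connected_graph (G k) /\ min_degree (G k) = d),
          (forall i j, (i < j)%N -> (#|G i| < #|G j|)%N),
          (forall k, 0 <= eps k) /\ (eps k @[k --> \oo] --> (0 : R)),
          (forall k, #|G k|%:R ^+ 2 * algebraic_connectivity R (G k)
                       <= (d%:R - 1) * pi ^+ 2 + eps k)
        & ((min_uncovered d (G k))%:R
             / (#|G k|%:R * (eps k + #|G k|%:R^-1) `^ p)
             @[k --> \oo] --> +oo)]).
Proof.
(* The same graphs and errors serve every [p] and both defects. *)
split=> p p_gt; exists (chains d), (gap R d); split.
- by move=> k; split; [apply: chains_connected|apply: chains_min_degree].
- exact: (ltn_card_chains R d_ge3).
- by split; [apply: gap_ge0|apply: cvg_gap].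
- by move=> k; apply: chain_connectivity; rewrite // leq_addl.
- by apply: chains_ratio_cvgy => // i; apply: chains_diam.
- by move=> k; split; [apply: chains_connected|apply: chains_min_degree].
- exact: (ltn_card_chains R d_ge3).
- by split; [apply: gap_ge0|apply: cvg_gap].
- by move=> k; apply: chain_connectivity; rewrite // leq_addl.
- by apply: chains_ratio_cvgy => // i; apply: chains_min_uncovered.
Qed.
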